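(* If a rule does not satisfy weak unanimity, then it does not satisfy strong unanimity as well. Hence, none of the extended rules AV, SAV, RAV, PAV, MAV satisfy unanimity.
   Context: Attribute-approval committee selection: there is a set of voters $V=\{v_1,\dots,v_n\}$, a set of candidates $C=\{c_1,\dots,c_m\}$, a number of dimensions $d$, and a target committee size $k$. Each candidate $c$ has a $d$-dimensional vector of attribute values $(c[1],\dots,c[d])$, with $c[j]$ from a domain $D^j$. Each voter $v_i$ submits, for every $j\in\{1,\dots,d\}$, the set $C_i^j\subseteq D^j$ of values that $v_i$ approves. A committee is a set $W\subseteq C$ of $k$ candidates. $W^j$ (respectively $C^j$) denotes the set of attributes of $W$ (respectively $C$) on dimension $j$. A rule selects a committee of size $k$ from the voters' approvals. For $X\subseteq C$ and a voter $v_i$, put $AV(X,v_i)=\sum_{c\in X}\frac{|\{j: c[j]\in C_i^j\}|}{d}$. Extended rules (the candidate-approval rules extended to attribute approvals; each selects a committee $W$ of size $k$): - AV selects $W$ with the highest $AV(W,V)=\sum_{v_i\in V}AV(W,v_i)$. - SAV selects $W$ maximizing $\sum_{v_i\in V}SAV(W,v_i)$, where $SAV(W,v_i)=\frac{AV(W,v_i)}{\min(AV(C,v_i),\,kd)}$, also written as $\frac{\sum_{j=1}^d|W^j\cap C_i^j|}{\min(\sum_{j=1}^d|C^j\cap C_i^j|,\,kd)}$. - RAV starts with $W=\emptyset$ and at every stage adds to $W$ a candidate $c$ maximizing $\sum_{v_i\in V}\frac{1}{1+AV(W,v_i)}\cdot\frac{|\{j: c[j]\in C_i^j\}|}{d}$,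 until $|W|=k$. - PAV selects $W$ maximizing $\sum_{v_i\in V}u(AV(W,v_i))$, where $u(p)=1+\frac12+\dots+\frac{1}{\lfloor p\rfloor}+\frac{1}{\lceil p\rceil}(p-\lfloor p\rfloor)$ (the last term being $0$ when $p$ is an integer). - MAV selects $W$ minimizing $\max_{v_i\in V}\max_{1\le j\le d}\frac{|W^j\setminus C_i^j|+|C_i^j\setminus W^j|}{|D^j|}$. Unanimity has two versions for attribute approvals. Weak unanimity of a committee $W$: if there is $j\in\{1,\dots,d\}$ with $\bigcap_{v_i\in V}C_i^j\ne\emptyset$, then there is $j'\in\{1,\dots,d\}$ with $\left(\bigcap_{v_i\in V}C_i^{j'}\right)\cap W^{j'}\neq\emptyset$. Strong unanimity of a committee $W$: for every $j\in\{1,\dots,d\}$ with $\bigcap_{v_i\in V} C_i^j\neq\emptyset$, one has $\left(\bigcap_{v_i\in V} C_i^j\right)\cap W^j\neq\emptyset$. A rule satisfies one of these properties if the committee it selects always satisfies it. *)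

(* Defs.v *)
(* Mathematical Components. *)
From HB Require Import structures.
From mathcomp Require Import all_boot all_order all_algebra.

Set Implicit Arguments.
Unset Strict Implicit.
Unset Printing Implicit Defensive.

Import Order.TTheory GRing.Theory Num.Theory.
Local Open Scope ring_scope.

(* Distinct candidates may share the same attribute vector, and a voter may
   approve values of [dom j] that no candidate has. *)
Record election := Election {
  nvoters : nat;
  ncands : nat;
  ndims : nat;
  size_com : nat;
  dom : 'I_ndims -> finType;
  attr : 'I_ncands -> forall j : 'I_ndims, dom j;
  appr : 'I_nvoters -> forall j : 'I_ndims, {set dom j};
  nvoters_gt0 : (0 < nvoters)%N;
  ndims_gt0 : (0 < ndims)%N;
  size_com_gt0 : (0 < size_com)%N;
  size_com_le : (size_com <= ncands)%N
}.

Definition voter (E : election) : finType := 'I_(nvoters E).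
Definition cand (E : election) : finType := 'I_(ncands E).
Definition dimension (E : election) : finType := 'I_(ndims E).

Definition committee (E : election) : Type :=
  {W : {set cand E} | #|W| == size_com E}.

(* Rules are resolute.  A rule given by an optimality criterion is any
   [f : rule] meeting that criterion on every election, so that quantifying
   over such [f] amounts to quantifying over all ways of breaking ties. *)
Definition rule : Type := forall E : election, committee E.

Section Scores.
Variable E : election.
Implicit Types (X W : {set cand E}) (v : voter E) (c : cand E) (j : dimension E).

(* W^j, a set: repeated values count once. *)
Definition values X j : {set dom j} := [set attr c j | c in X].

Definition cand_score v c : rat :=
  #|[set j : dimension E | attr c j \in appr v j]|%:R / (ndims E)%:R.

Definition AV_voter X v : rat := \sum_(c in X) cand_score v c.

Definition AV_score X : rat := \sum_v AV_voter X v.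

(* A voter who approves no attribute of any candidate has numerator and
   denominator 0, and contributes 0. *)
Definition SAV_score X : rat :=
  \sum_v AV_voter X v
         / Num.min (AV_voter [set: cand E] v) (size_com E * ndims E)%:R.

(* The form of the SAV score that counts attribute values; it is not equal to
   [SAV_score] in general. *)
Definition SAV_values_score X : rat :=
  \sum_v (\sum_j #|values X j :&: appr v j|)%:R
         / (minn (\sum_j #|values [set: cand E] j :&: appr v j|)
                 (size_com E * ndims E))%:R.

Definition RAV_gain W c : rat :=
  \sum_v (1 + AV_voter W v)^-1 * cand_score v c.

Inductive RAV_reachable : {set cand E} -> Prop :=
| RAV_start : RAV_reachable set0
| RAV_stage W c :
    RAV_reachable W -> c \notin W ->
    (forall c', c' \notin W -> RAV_gain W c' <= RAV_gain W c) ->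
    RAV_reachable (c |: W).

(* For [0 <= p].  The last term is 0 when p is an integer, p = 0 included. *)
Definition PAV_utility (p : rat) : rat :=
  \sum_(1 <= t < (Num.truncn p).+1) t%:R^-1
  + (Num.ceil p)%:~R^-1 * (p - (Num.floor p)%:~R).

Definition PAV_score X : rat := \sum_v PAV_utility (AV_voter X v).

(* All the terms are nonnegative and there are voters and dimensions, so the
   default value 0 does not affect the maxima. *)
Definition MAV_score X : rat :=
  \big[Num.max/0]_v \big[Num.max/0]_j
    ((#|values X j :\: appr v j| + #|appr v j :\: values X j|)%:R
     / #|dom j|%:R).

Definition common j : {set dom j} := \bigcap_(v : voter E) appr v j.

Definition weakly_unanimous W : Prop :=
  (exists j, common j != set0) ->
  exists j', common j' :&: values W j' != set0.

Definition strongly_unanimous W : Prop :=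
  forall j, common j != set0 -> common j :&: values W j != set0.

End Scores.

Definition maximizes (score : forall E : election, {set cand E} -> rat)
    (f : rule) : Prop :=
  forall (E : election) (W : committee E), score E (val W) <= score E (val (f E)).

Definition minimizes (score : forall E : election, {set cand E} -> rat)
    (f : rule) : Prop :=
  forall (E : election) (W : committee E), score E (val (f E)) <= score E (val W).

Definition is_AV : rule -> Prop := maximizes AV_score.
Definition is_SAV : rule -> Prop := maximizes SAV_score.
Definition is_SAV_values : rule -> Prop := maximizes SAV_values_score.
Definition is_RAV (f : rule) : Prop :=
  forall E : election, RAV_reachable (val (f E)).
Definition is_PAV : rule -> Prop := maximizes PAV_score.
Definition is_MAV : rule -> Prop := minimizes MAV_score.

Definition extended_rule (f : rule) : Prop :=
  is_AV f \/ is_SAV f \/ is_SAV_values f \/ is_RAV f \/ is_PAV f \/ is_MAV f.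

Definition weak_unanimity (f : rule) : Prop :=
  forall E : election, weakly_unanimous (val (f E)).

Definition strong_unanimity (f : rule) : Prop :=
  forall E : election, strongly_unanimous (val (f E)).

(* The intersections of approval sets are taken inside the domains, so a value
   that no candidate has may be approved unanimously; if that is the
   only kind of agreement, no committee is unanimous.  The properties below only consider elections
   in which every value of every domain occurs (C^j = D^j), where weak
   unanimity can always be met. *)
Definition all_values_occur (E : election) : Prop :=
  forall j : dimension E, values [set: cand E] j = [set: dom j].

Definition weak_unanimity_occurring (f : rule) : Prop :=
  forall E : election, all_values_occur E -> weakly_unanimous (val (f E)).

Definition strong_unanimity_occurring (f : rule) : Prop :=
  forall E : election, all_values_occur E -> strongly_unanimous (val (f E)).

(* Main.v *)
(** The intersection over a common dimension in strong unanimity is a witness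
    for weak unanimity.  A single election defeats all the rules: one candidate
    is selected out of [0, 1, 2], candidate [c] having the value [c] on each of
    four dimensions.  All three voters approve exactly [0] on dimension 0; voter
    [v] approves nothing on dimension [v + 1] and exactly [1] and [2] on the two
    remaining dimensions.  Only [0] on dimension 0 is approved unanimously, but
    each voter approves one attribute of candidate 0 and two attributes of every
    other candidate, and candidate 0 has Hamming distance 3 (out of 3) to some
    approval sets whereas candidate 1 stays within distance 2. *)
From mathcomp Require Import all_boot all_order all_algebra.
From mathcomp Require Import lra.
Require Import Defs.

Set Implicit Arguments.
Unset Strict Implicit.
Unset Printing Implicit Defensive.

Import Order.TTheory GRing.Theory Num.Theory.
Local Open Scope ring_scope.

Lemma strongly_unanimous_weakly (E : election) (W : {set cand E}) :
  strongly_unanimous W -> weakly_unanimous W.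
Proof. by move=> sW [j cj]; exists j; apply: sW. Qed.

Lemma weak_unanimity_occurringW (f : rule) :
  weak_unanimity f -> weak_unanimity_occurring f.
Proof. by move=> wf E _; apply: wf. Qed.

Lemma values_set1 (E : election) (c : cand E) (j : dimension E) :
  values [set c] j = [set attr c j].
Proof. exact: imset_set1. Qed.

Lemma AV_voter0 (E : election) (v : voter E) : AV_voter set0 v = 0.
Proof. exact: big_set0. Qed.

Lemma AV_voter_set1 (E : election) (c : cand E) (v : voter E) :
  AV_voter [set c] v = cand_score v c.
Proof. exact: big_set1. Qed.

Lemma RAV_gain0 (E : election) (c : cand E) :
  RAV_gain set0 c = \sum_v cand_score v c.
Proof. by apply: eq_bigr => v _; rewrite AV_voter0 addr0 invr1 mul1r. Qed.

(** A stage that produces a singleton adds its candidate to the empty set, so it is the first stage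
    and every candidate competes in it. *)
Lemma RAV_reachable_set1 (E : election) (c : cand E) :
  RAV_reachable [set c] ->
  forall c' : cand E, RAV_gain set0 c' <= RAV_gain set0 c.
Proof.
move eX: [set c] => X rX.
case: rX eX => [/setP/(_ c)|W a _ aW maxa eW]; first by rewrite !inE eqxx.
have W0 : W = set0.
  by apply/eqP; rewrite -cards_eq0; have := cardsU1 a W;
     rewrite -eW cards1 aW add1n => -[<-].
rewrite {}W0 in eW maxa *.
have -> : c = a by apply/eqP; move/setP/(_ c): eW; rewrite !inE eqxx orbF.
by move=> c'; apply: maxa; rewrite inE.
Qed.

(** The harmonic sum is empty and the ceiling is 1, so only the fractional term remains. On scores
    in this range PAV agrees with AV. *)
Lemma PAV_utility_small (p : rat) : 0 < p < 1 -> PAV_utility p = p.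
Proof.
case/andP=> p0 p1; rewrite /PAV_utility.
have -> : Num.truncn p = 0%N.
  by apply: truncn_def; rewrite ltW.
have -> : Num.floor p = 0 by apply: floor_def; rewrite ltW.
have -> : Num.ceil p = 1.
  by apply: ceil_def; rewrite subrr p0 ltW.
by rewrite big_geq // add0r invr1 mul1r subr0.
Qed.

Definition cex_appr (v : 'I_3) (j : 'I_4) : {set 'I_3} :=
  if j == ord0 then [set ord0]
  else if j == lift ord0 v then set0 else [set~ ord0].

Definition cex : election :=
  @Election 3 3 4 1 (fun _ => 'I_3) (fun c _ => c) cex_appr isT isT isT isT.

Lemma cex_common0 : common (ord0 : dimension cex) = [set ord0].
Proof.
apply/setP => x; apply/bigcapP/idP => [/(_ ord0 isT)|x0 v _];
  by rewrite /= /cex_appr eqxx.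
Qed.

(** Each such dimension is [lift ord0 v] for some voter [v], who approves nothing on it. *)
Lemma cex_common_neq0 (j : dimension cex) : j != ord0 -> common j = set0.
Proof.
case: (unliftP ord0 j) => [v ->|->]; last by rewrite eqxx.
move=> _; apply/setP => x; rewrite inE; apply/bigcapP => /(_ v isT).
by rewrite /= /cex_appr eqxx inE.
Qed.

Lemma cex_all_values_occur : all_values_occur cex.
Proof. by move=> j; exact: imset_id. Qed.

Lemma cex_committee_set1 (W : committee cex) :
  exists c : cand cex, val W = [set c].
Proof. exact/cards1P/(valP W). Qed.

Lemma cex_not_weakly_unanimous (c : cand cex) :
  c != ord0 -> ~ weakly_unanimous [set c].
Proof.
move=> c0 [].
  exists ord0; rewrite cex_common0.
  by apply/set0Pn; exists ord0; exact: set11.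
move=> j; rewrite values_set1 /=; have [->|j0] := eqVneq j ord0.
  rewrite cex_common0 setIC => /set0Pn[x].
  by rewrite !inE => /andP[/eqP ->]; apply/negP.
by rewrite cex_common_neq0 // set0I eqxx.
Qed.

Lemma cex_approved0 (v : voter cex) :
  [set j : dimension cex | attr (ord0 : cand cex) j \in appr v j] = [set ord0].
Proof.
apply/setP => j; rewrite !inE /= /cex_appr.
by have [_|_] := eqVneq j ord0; [rewrite set11 | case: ifP; rewrite !inE].
Qed.

Lemma cex_approved_neq0 (v : voter cex) (c : cand cex) : c != ord0 ->
  [set j : dimension cex | attr c j \in appr v j] = ~: [set ord0; lift ord0 v].
Proof.
move=> c0; apply/setP => j; rewrite !inE /= /cex_appr.
have [_|_] := eqVneq j ord0; first by rewrite inE (negbTE c0).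
by case: ifP => _; rewrite !inE.
Qed.

Lemma cex_score0 (v : voter cex) : cand_score v (ord0 : cand cex) = 1 / 4.
Proof. by rewrite /cand_score cex_approved0 cards1. Qed.

Lemma cex_score_neq0 (v : voter cex) (c : cand cex) :
  c != ord0 -> cand_score v c = 2 / 4.
Proof.
by move=> c0; rewrite /cand_score cex_approved_neq0 // cardsCs setCK cards2 card_ord.
Qed.

Lemma cex_score_lt (v : voter cex) (c : cand cex) : c != ord0 ->
  cand_score v (ord0 : cand cex) < cand_score v c.
Proof. by move=> c0; rewrite cex_score0 cex_score_neq0 //; lra. Qed.

(** The positivity of this value lets the SAV denominator, which is the same for all committees, be
    cancelled. *)
Lemma cex_AV_voterT (v : voter cex) : AV_voter [set: cand cex] v = 5 / 4.
Proof.
rewrite /AV_voter (bigD1 ord0) ?inE //= cex_score0.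
rewrite (eq_bigr (fun=> 2 / 4)) => [|c]; last by rewrite inE; exact: cex_score_neq0.
rewrite sumr_const.
have -> : #|[pred i : cand cex | (i \in [set: cand cex]) & (i != ord0)]| = 2%N.
  rewrite (@eq_card _ _ (mem [set~ (ord0 : cand cex)])) ?cardsC1 ?card_ord //.
  by move=> i; rewrite !inE.
by lra.
Qed.

Lemma cex_sum_lt (g h : voter cex -> rat) :
  (forall v, g v < h v) -> \sum_v g v < \sum_v h v.
Proof.
move=> gh; apply: ltr_sum => //.
by apply/hasP; exists ord0; rewrite ?mem_index_enum.
Qed.

Definition cex_cand1 : cand cex := lift ord0 ord0.

Lemma cex_AV : AV_score [set (ord0 : cand cex)] < AV_score [set cex_cand1].
Proof. by apply: cex_sum_lt => v; rewrite !AV_voter_set1 cex_score_lt. Qed.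

Lemma cex_SAV : SAV_score [set (ord0 : cand cex)] < SAV_score [set cex_cand1].
Proof.
apply: cex_sum_lt => v; rewrite !AV_voter_set1 ltr_pM2r ?cex_score_lt //.
by rewrite invr_gt0 lt_min cex_AV_voterT ltr0n.
Qed.

(** A single candidate has one value per dimension, so no repeated values collapse. *)
Lemma sum_card_values_set1 (E : election) (c : cand E) (v : voter E) :
  (\sum_j #|values [set c] j :&: appr v j| =
   #|[set j : dimension E | attr c j \in appr v j]|)%N.
Proof.
rewrite -sum1_card big_mkcond [RHS]big_mkcond; apply: eq_bigr => j _.
rewrite values_set1 inE; case: ifP => cj.
  by rewrite (setIidPl _) ?cards1 ?sub1set.
by apply/eqP; rewrite cards_eq0 setI_eq0 disjoints1 cj.
Qed.

Lemma cex_SAV_values :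
  SAV_values_score [set (ord0 : cand cex)] < SAV_values_score [set cex_cand1].
Proof.
apply: cex_sum_lt => v; rewrite !sum_card_values_set1 ltr_pM2r.
  rewrite cex_approved0 cex_approved_neq0 // [in ltRHS]cardsCs setCK.
  by rewrite cards1 cards2 card_ord.
(* The denominator is positive: the value 0, approved on dimension 0, already contributes 1. *)
rewrite invr_gt0 ltr0n leq_min andbT (bigD1 ord0) //= addn_gt0.
by rewrite cex_all_values_occur setTI /cex_appr eqxx cards1.
Qed.

Lemma cex_RAV :
  RAV_gain set0 (ord0 : cand cex) < RAV_gain set0 cex_cand1.
Proof. by rewrite !RAV_gain0; apply: cex_sum_lt => v; rewrite cex_score_lt. Qed.

Lemma cex_PAV : PAV_score [set (ord0 : cand cex)] < PAV_score [set cex_cand1].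
Proof.
apply: cex_sum_lt => v; rewrite !AV_voter_set1.
by rewrite !PAV_utility_small ?cex_score_lt ?cex_score0 ?cex_score_neq0 //; lra.
Qed.

Lemma cex_MAV0 : 1 <= MAV_score [set (ord0 : cand cex)].
Proof.
(* Voter 0 approves exactly 1 and 2 on the last dimension, the complement of the value of candidate
   0. *)
apply: le_trans (le_bigmax _ _ (ord0 : voter cex)).
apply: le_trans (le_bigmax _ _ (ord_max : dimension cex)).
rewrite values_set1 /= /cex_appr /= card_ord.
have -> : [set ord0] :\: [set~ ord0] = [set ord0] :> {set 'I_3}.
  by rewrite setDE setCK setIid.
have -> : [set~ ord0] :\: [set ord0] = [set~ ord0] :> {set 'I_3}.
  by rewrite setDE setIid.
by rewrite cards1 cardsC1 card_ord.
Qed.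

Lemma cex_MAV1 : MAV_score [set cex_cand1] < 1.
Proof.
apply: bigmax_lt => // v _; apply: bigmax_lt => // j _.
rewrite values_set1 /= card_ord ltr_pdivrMr // mul1r ltr_nat ltnS.
(* The bound 2 allows one value of the committee that is not approved and one approved value that
   the committee lacks. *)
rewrite -[2%N]/(1 + 1)%N leq_add //.
  by apply: leq_trans (subset_leq_card (subsetDl _ _)) _; rewrite cards1.
rewrite /cex_appr; case: ifP => _.
  by apply: leq_trans (subset_leq_card (subsetDl _ _)) _; rewrite cards1.
case: ifP => _; first by rewrite set0D cards0.
(* The approval set has two elements, one of them the value 1 of the committee. *)
have := cardsD1 cex_cand1 [set~ ord0].
by rewrite cardsC1 card_ord !inE => /esym[]; rewrite add0n => ->.
Qed.

(** Candidate 1 beats candidate 0 strictly under every criterion, so no way of breaking ties can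
    select candidate 0. *)
Lemma extended_rule_cex (f : rule) : extended_rule f ->
  exists2 c : cand cex, c != ord0 & val (f cex) = [set c].
Proof.
move=> ef; have [c fc] := cex_committee_set1 (f cex).
exists c => //; apply/eqP => c0; rewrite {c}c0 in fc.
pose W : committee cex := exist _ [set cex_cand1] (introT eqP (cards1 cex_cand1)).
case: ef => [|[|[|[|[]]]]].
- by move=> /(_ cex W); rewrite fc leNgt cex_AV.
- by move=> /(_ cex W); rewrite fc leNgt cex_SAV.
- by move=> /(_ cex W); rewrite fc leNgt cex_SAV_values.
- move=> /(_ cex); rewrite fc => /RAV_reachable_set1/(_ cex_cand1).
  by rewrite leNgt cex_RAV.
- by move=> /(_ cex W); rewrite fc leNgt cex_PAV.
- by move=> /(_ cex W); rewrite fc leNgt (lt_le_trans cex_MAV1 cex_MAV0).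
Qed.

Lemma extended_rule_not_weak (f : rule) :
  extended_rule f -> ~ weak_unanimity_occurring f.
Proof.
move=> /extended_rule_cex[c c0 fc] /(_ cex cex_all_values_occur).
by rewrite fc; exact: cex_not_weakly_unanimous.
Qed.

Theorem proposition1 :
  (forall f : rule, ~ weak_unanimity f -> ~ strong_unanimity f) /\
  (forall f : rule, extended_rule f ->
     ~ weak_unanimity f /\ ~ strong_unanimity f) /\
  (forall f : rule, ~ weak_unanimity_occurring f ->
     ~ strong_unanimity_occurring f) /\
  (forall f : rule, extended_rule f ->
     ~ weak_unanimity_occurring f /\ ~ strong_unanimity_occurring f).
Proof.
have sw (f : rule) : strong_unanimity f -> weak_unanimity f.
  by move=> sf E; apply: strongly_unanimous_weakly.
have swo (f : rule) : strong_unanimity_occurring f -> weak_unanimity_occurring f.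
  by move=> sf E oE; apply: strongly_unanimous_weakly; apply: sf.
split; first by move=> f nw /sw.
split; last first.
  split=> f; first by move=> nw /swo.
  by move=> /extended_rule_not_weak nw; split=> // /swo.
(* Failure on elections where all values occur refutes weak unanimity in general, and with it strong
   unanimity. *)
by move=> f /extended_rule_not_weak nw; split=> [|/sw] /weak_unanimity_occurringW.
Qed.
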